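(* The ordinary generating function $\mathcal{F}(q)=\sum_{n\ge0}b(n)q^n$ of block-separated overpartitions satisfies $$\mathcal{F}(q)=\begin{pmatrix}1&0\end{pmatrix}\left(\prod_{j\ge 1}M_j(q)\right)\begin{pmatrix}1\\1\end{pmatrix},$$ where $$M_j(q)=\begin{pmatrix}\dfrac{1}{1-q^j}&\dfrac{q^j}{1-q^j}\\[5pt]\dfrac{q^j}{1-q^j}&1\end{pmatrix}\qquad(j\ge 1).$$
   Context: A partition of $n$ is written in block form $(d_1^{m_1},\dots,d_r^{m_r})$ with $d_1>d_2>\cdots>d_r\ge 1$, multiplicities $m_i\ge 1$, and $\sum_i m_i d_i=n$. An overpartition of $n$ is a partition of $n$ in which the first occurrence of each distinct part may optionally be overlined; let $x_i\in\{0,1\}$ equal $1$ if and only if the first occurrence in the block $d_i^{m_i}$ is overlined. An overpartition is block-separated if no two consecutive distinct blocks are both overlined, i.e. $x_i x_{i+1}=0$ for all $i=1,\dots,r-1$. $b(n)$ is the number of block-separated overpartitions of $n$, with $b(0)=1$ (the empty overpartition). The identity is one of formal power series in $q$; the infinite matrix product $\prod_{j\ge1}M_j(q)=M_1(q)M_2(q)M_3(q)\cdots$ is taken in increasing order of $j$ from left to right, and is understood as the coefficientwise limit of the finite products. *)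

(* Defs.v *)
From HB Require Import structures.
From mathcomp Require Import all_boot all_order all_algebra.
From mathcomp Require Import boolp.

Set Implicit Arguments.
Unset Strict Implicit.
Unset Printing Implicit Defensive.

Import GRing.Theory.

Local Open Scope ring_scope.

(* A wrapper around nat -> R: the pointwise algebraic structures on functions *)
(* are not the ones wanted here. The choice structure is classical.           *)
Record fps (R : Type) := FPS { coefs :> nat -> R }.

Notation "{ 'fps' R }" := (fps R) (at level 0, format "{ 'fps'  R }") : type_scope.

HB.instance Definition _ (R : Type) := gen_eqMixin {fps R}.
HB.instance Definition _ (R : Type) := gen_choiceMixin {fps R}.

Lemma fpsP (R : Type) (f g : {fps R}) : (forall n, f n = g n) <-> f = g.
Proof.
split=> [|-> //]; case: f g => [f] [g] /= fg.
by congr FPS; apply: funext.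
Qed.

Section FpsZmodule.
Variable R : zmodType.
Implicit Types f g h : {fps R}.

Definition fps_zero : {fps R} := FPS (fun=> 0).
Definition fps_opp f : {fps R} := FPS (fun n => - f n).
Definition fps_add f g : {fps R} := FPS (fun n => f n + g n).

Fact fps_addA : associative fps_add.
Proof. by move=> f g h; apply/fpsP => n; apply: addrA. Qed.
Fact fps_addC : commutative fps_add.
Proof. by move=> f g; apply/fpsP => n; apply: addrC. Qed.
Fact fps_add0 : left_id fps_zero fps_add.
Proof. by move=> f; apply/fpsP => n; apply: add0r. Qed.
Fact fps_addN : left_inverse fps_zero fps_opp fps_add.
Proof. by move=> f; apply/fpsP => n; apply: addNr. Qed.

HB.instance Definition _ :=
  GRing.isZmodule.Build {fps R} fps_addA fps_addC fps_add0 fps_addN.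
End FpsZmodule.

Section FpsRing.
Variable R : comNzRingType.
Implicit Types f g h : {fps R}.

Definition fps_one : {fps R} := FPS (fun n => (n == 0)%:R).
Definition fps_mul f g : {fps R} := FPS (fun n => \sum_(i < n.+1) f i * g (n - i)%N).

Let trunc n f : {poly R} := \poly_(i < n.+1) f i.

Let coef_trunc_mul m n f g :
  (n <= m)%N -> fps_mul f g n = (trunc m f * trunc m g)`_n.
Proof.
move=> le_nm; rewrite coefM; apply: eq_bigr => i _.
rewrite !coef_poly !ltnS (leq_trans _ le_nm) ?leq_subr ?(leq_trans (leq_subr _ _) le_nm) //.
by rewrite -ltnS.
Qed.

Let coef_trunc m n f : (n <= m)%N -> (trunc m f)`_n = f n.
Proof. by move=> le_nm; rewrite coef_poly ltnS le_nm. Qed.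

Fact fps_mulA : associative fps_mul.
Proof.
move=> f g h; apply/fpsP => n.
have -> : fps_mul f (fps_mul g h) n = (trunc n f * (trunc n g * trunc n h))`_n.
  rewrite coefM; apply: eq_bigr => i _.
  by rewrite coef_trunc ?(leq_ord i) // (@coef_trunc_mul n) ?leq_subr.
have -> : fps_mul (fps_mul f g) h n = (trunc n f * trunc n g * trunc n h)`_n.
  rewrite coefM; apply: eq_bigr => i _.
  by rewrite coef_trunc ?leq_subr // (@coef_trunc_mul n) ?(leq_ord i).
by rewrite mulrA.
Qed.

Fact fps_mulC : commutative fps_mul.
Proof. by move=> f g; apply/fpsP => n; rewrite !(@coef_trunc_mul n) // mulrC. Qed.

Fact fps_mul1 : left_id fps_one fps_mul.
Proof.
move=> f; apply/fpsP => n; rewrite /= big_ord_recl /= mul1r subn0.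
by rewrite big1 ?addr0 // => i _; rewrite mul0r.
Qed.

Fact fps_mulDl : left_distributive fps_mul +%R.
Proof.
move=> f g h; apply/fpsP => n /=; rewrite -big_split /=.
by apply: eq_bigr => i _; rewrite mulrDl.
Qed.

Fact fps_one_neq0 : fps_one != 0.
Proof. by apply/eqP => /fpsP/(_ 0)/eqP; rewrite oner_eq0. Qed.

HB.instance Definition _ := GRing.Zmodule_isComNzRing.Build {fps R}
  fps_mulA fps_mulC fps_mul1 fps_mulDl fps_one_neq0.

(* Following the library convention, the inverse of a non-unit is itself.     *)
Definition fps_unit : {pred {fps R}} := fun f => `[< exists g, g * f = 1 >].
Definition fps_inv f : {fps R} :=
  if pselect (exists g, g * f = 1) is left ex_g then projT1 (cid ex_g) else f.

Fact fps_mulVx : {in fps_unit, left_inverse 1 fps_inv *%R}.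
Proof.
move=> f /asboolP ex_g; rewrite /fps_inv.
by case: pselect => // {}ex_g; case: cid.
Qed.
Fact fps_unitPl f g : g * f = 1 -> fps_unit f.
Proof. by move=> gf1; apply/asboolP; exists g. Qed.
Fact fps_inv_out : {in [predC fps_unit], fps_inv =1 id}.
Proof.
by move=> f /asboolP nex_g; rewrite /fps_inv; case: pselect.
Qed.

HB.instance Definition _ := GRing.ComNzRing_hasMulInverse.Build {fps R}
  fps_mulVx fps_unitPl fps_inv_out.

Definition fpsX : {fps R} := FPS (fun n => (n == 1)%:R).

Lemma coefs_fpsXnM j f n :
  (fpsX ^+ j * f) n = if (n < j)%N then 0 else f (n - j)%N.
Proof.
have XM g k : (fpsX * g) k = if k is k'.+1 then g k' else 0.
  rewrite [LHS]/= big_ord_recl /= mul0r add0r.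
  case: k => [|k]; first by rewrite big_ord0.
  rewrite big_ord_recl big1 /= => [|i _]; last by rewrite mul0r.
  by rewrite mul1r addr0 /bump /= subn1.
elim: j n => [|j IHj] n; first by rewrite mul1r subn0.
by rewrite exprS -mulrA XM; case: n => [|n] //; rewrite IHj.
Qed.

Lemma unitr_1subXn j : (0 < j)%N -> 1 - fpsX ^+ j \is a GRing.unit.
Proof.
move=> j_gt0; pose g : {fps R} := FPS (fun n => (j %| n)%:R).
apply: (@fps_unitPl _ g); rewrite mulrC mulrBl mul1r; apply/fpsP => n.
transitivity (g n - (fpsX ^+ j * g) n) => //; rewrite coefs_fpsXnM /=.
case: ltnP => [n_lt_j|j_le_n].
  by rewrite subr0 /dvdn modn_small.
rewrite -{1}(subnK j_le_n) dvdn_addl // subrr.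
by rewrite (gtn_eqF (leq_trans j_gt0 j_le_n)).
Qed.

End FpsRing.

Notation "''q'" := (fpsX int) (at level 0) : ring_scope.

Definition fps_cvg (R : Type) (u : nat -> {fps R}) (l : {fps R}) : Prop :=
  forall k, exists N, forall n, (N <= n)%N -> u n k = l k.

Definition mx_infprod_cvg (R : comNzRingType) (d : nat)
    (A : nat -> 'M[{fps R}]_d.+1) (P : 'M[{fps R}]_d.+1) : Prop :=
  forall i k, fps_cvg (fun n => (\prod_(1 <= j < n.+1) A j) i k) (P i k).

Lemma mx_infprod_cvg_unique (R : comNzRingType) (d : nat)
    (A : nat -> 'M[{fps R}]_d.+1) (P Q : 'M[{fps R}]_d.+1) :
  mx_infprod_cvg A P -> mx_infprod_cvg A Q -> P = Q.
Proof.
move=> cvP cvQ; apply/matrixP => i k; apply/fpsP => m.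
have [N1 P_N1] := cvP i k m; have [N2 Q_N2] := cvQ i k m.
by rewrite -(P_N1 (maxn N1 N2)) ?leq_maxl // Q_N2 ?leq_maxr.
Qed.

(* A triple (d, m, x) encodes a block d^m, together with whether the first    *)
(* occurrence of the part d is overlined.                                     *)
Definition block : Type := (nat * nat * bool)%type.
Definition part (c : block) : nat := c.1.1.
Definition mult (c : block) : nat := c.1.2.
Definition overlined (c : block) : bool := c.2.

Definition overpartition (n : nat) (s : seq block) : bool :=
  [&& sorted gtn (map part s),
      all (fun c => (0 < part c)%N && (0 < mult c)%N) s
    & (\sum_(c <- s) mult c * part c)%N == n].

Definition block_separated (s : seq block) : bool :=
  sorted (fun c c' => ~~ (overlined c && overlined c')) s.

(* An overpartition of n has at most n blocks, with parts and multiplicities  *)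
(* at most n (see overpartition_bounded), so that the overpartitions of n are *)
(* found among the members of the following finite type.                      *)
Notation bounded_blocks n := (n.-bseq ('I_n.+1 * 'I_n.+1 * bool)).

Definition to_blocks (n : nat) (s : bounded_blocks n) : seq block :=
  [seq (nat_of_ord c.1.1, nat_of_ord c.1.2, c.2) | c <- s].

Lemma to_blocks_inj n : injective (@to_blocks n).
Proof.
move=> s t /inj_map eq_st; apply/val_inj/eq_st.
by move=> [[d m] x] [[d' m'] x'] /= [/val_inj-> /val_inj-> ->].
Qed.

Lemma overpartition_bounded n s :
  overpartition n s -> exists t : bounded_blocks n, to_blocks t = s.
Proof.
case/and3P=> _ /allP s_gt0 /eqP sum_s.
have size_s : (size s <= n)%N.
  rewrite -sum_s -sum1_size big_seq [leqRHS]big_seq.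
  by apply: leq_sum => c /s_gt0/andP[? ?]; rewrite muln_gt0; apply/andP.
have le_n c : c \in s -> (part c <= n)%N && (mult c <= n)%N.
  move=> c_s; have /andP[d_gt0 m_gt0] := s_gt0 c c_s.
  have le_c : (mult c * part c <= n)%N.
    by rewrite -sum_s (big_rem c c_s) leq_addr.
  by rewrite !(leq_trans _ le_c) ?leq_pmull ?leq_pmulr.
pose f (c : block) : 'I_n.+1 * 'I_n.+1 * bool :=
  (inord (part c), inord (mult c), overlined c).
have size_fs : (size (map f s) <= n)%N by rewrite size_map.
exists (Bseq size_fs); rewrite /to_blocks /= -map_comp.
rewrite -[RHS]map_id; apply/eq_in_map => -[[d m] x] /le_n/andP[/= d_n m_n].
by rewrite !inordK.
Qed.

Definition b (n : nat) : nat :=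
  #|[set s : bounded_blocks n
      | overpartition n (to_blocks s) && block_separated (to_blocks s)]|.

Lemma b0 : b 0 = 1%N.
Proof.
rewrite /b (_ : [set s | _] = [set [bseq]]) ?cards1 //.
apply/setP => s; rewrite (bseq0 s) !inE eqxx.
by rewrite /overpartition big_nil.
Qed.

Definition F : {fps int} := FPS (fun n => (b n)%:Z).

Definition M (j : nat) : 'M[{fps int}]_2 :=
  (block_mx (1 / (1 - 'q ^+ j))%:M       ('q ^+ j / (1 - 'q ^+ j))%:M
            ('q ^+ j / (1 - 'q ^+ j))%:M 1%:M : 'M_(1 + 1)).

(* Main.v *)
(** Read from its smallest part upwards, an overpartition is a walk on two
    states that record whether the last block met is overlined.  At step [j],
    either the part [j] is absent and the state is kept, or a block of [j]'s is
    added, contributing [q^j / (1 - q^j)], and the state becomes its overlining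
    bit; separation only forbids going from the overlined state to itself in
    this way.  Hence [M j] is the matrix of step [j], and the first row of
    [M 1 * ... * M N] counts the block-separated overpartitions with parts at
    most [N] by the overlining of their largest block.  The infinite product
    converges since [M j] is the identity modulo [q^j]. *)
Require Import Defs.
From mathcomp Require Import all_boot all_order all_algebra.
Import GRing.Theory.
Local Open Scope ring_scope.

(** * Listing separated overpartitions by largest part and state *)

Definition starts_overlined (s : seq block) : bool :=
  if s is c :: _ then overlined c else false.

(** Since parts decrease along the list, prepending [N.+1] to the path bounds all of them by [N]. *)
Definition separated_overpartition (N n : nat) (s : seq block) : bool :=
  [&& path gtn N.+1 (map part s),
      all (fun c => (0 < part c)%N && (0 < mult c)%N) s,
      (\sum_(c <- s) mult c * part c)%N == n
    & block_separated s].

(* [w] is the total weight of the block of parts [N'.+1]. *)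
Fixpoint separated_list (N : nat) (x : bool) (n : nat) : seq (seq block) :=
  if N is N'.+1 then
    separated_list N' x n ++
    [seq (N, w %/ N, x)%N :: s
       | w <- [seq w <- index_iota 0 n.+1 | (0 < w)%N && (N %| w)%N],
         s <- separated_list N' false (n - w)
              ++ (if x then [::] else separated_list N' true (n - w))]
  else if (n == 0)%N && ~~ x then [:: [::]] else [::].

Lemma separated_listS N x n :
  separated_list N.+1 x n =
  separated_list N x n ++
  [seq (N.+1, w %/ N.+1, x)%N :: s
     | w <- [seq w <- index_iota 0 n.+1 | (0 < w)%N && (N.+1 %| w)%N],
       s <- separated_list N false (n - w)
            ++ (if x then [::] else separated_list N true (n - w))].
Proof. by []. Qed.

Arguments separated_list : simpl never.

Lemma separated_overpartition_cons N n c s :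
  separated_overpartition N n (c :: s) =
  [&& (0 < part c <= N)%N, (0 < mult c)%N, (mult c * part c <= n)%N,
      ~~ (overlined c && starts_overlined s)
    & separated_overpartition (part c).-1 (n - mult c * part c) s].
Proof.
rewrite /separated_overpartition big_cons.
have -> : block_separated (c :: s) =
    ~~ (overlined c && starts_overlined s) && block_separated s.
  by case: s => [|c' s] //=; rewrite andbF.
rewrite /= ltnS; case: (posnP (part c)) => [->|c_gt0] /=; first by rewrite andbF.
rewrite prednK //.
(* Subtraction on [nat] truncates, so the bound has to accompany the equation for the tail. *)
have -> : (mult c * part c + \sum_(c' <- s) mult c' * part c' == n)%N =
    (mult c * part c <= n)%N &&
    (\sum_(c' <- s) mult c' * part c' == n - mult c * part c)%N.
  case: leqP => [le_n|lt_n] /=.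
    by rewrite -{1}(subnKC le_n) eqn_add2l.
  by apply/negbTE; rewrite neq_ltn (leq_trans lt_n) ?leq_addr ?orbT.
rewrite -!andbA; do !bool_congr.
Qed.

(** The state [x] is the overlining of the largest block, with [false] for the empty list. The
    induction on [N] splits on whether that block has part [N.+1]. *)
Lemma mem_separated_list N x n s :
  (s \in separated_list N x n) =
  separated_overpartition N n s && (starts_overlined s == x).
Proof.
elim: N x n s => [|N IH] x n s.
  rewrite /separated_list; case: s => [|c s] /=.
    rewrite /separated_overpartition big_nil /= eq_sym andbT.
    by case: eqP; case: x.
  rewrite separated_overpartition_cons.
  have -> : (0 < part c <= 0)%N = false by case: part.
  by case: ifP.
apply/idP/idP.
- rewrite separated_listS mem_cat IH; case/orP=> [|/allpairsPdep[w [t [w_in t_in ->]]]].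
    case: s => [|c s] //; rewrite !separated_overpartition_cons.
    case/andP=> /and5P[/andP[-> /leqW->] -> -> -> ->] ->.
    by [].
  move: w_in; rewrite mem_filter mem_index_iota ltnS /=.
  case/andP=> /andP[w_gt0 dvd_w] w_le.
  rewrite separated_overpartition_cons /part /mult /overlined /= divnK //.
  rewrite leqnn divn_gt0 // dvdn_leq // w_le eqxx andbT /=.
  move: t_in; rewrite mem_cat IH; case: x => /=.
    by rewrite orbF => /andP[-> /eqP->].
  by rewrite IH => /orP[] /andP[->].
- case: s => [|[[d m] y] s].
    by rewrite separated_listS mem_cat IH => H; apply/orP; left.
  rewrite !separated_overpartition_cons /part /mult /overlined /=.
  case/andP=> /and5P[/andP[d_gt0 d_le] m_gt0 le_n sep_s sop_s] /eqP eq_y.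
  subst y; rewrite separated_listS mem_cat IH.
  move: d_le; rewrite leq_eqVlt => /orP[/eqP eq_d|]; last first.
    by rewrite ltnS => d_le; rewrite separated_overpartition_cons /part /= d_le d_gt0 m_gt0 le_n sep_s sop_s eqxx.
  apply/orP; right; subst d; apply/allpairsPdep; exists (m * N.+1)%N, s.
  split; last by rewrite mulnK.
    by rewrite mem_filter mem_index_iota muln_gt0 m_gt0 dvdn_mull ?ltnS.
  rewrite mem_cat IH sop_s; case: x sep_s => /=; first by move/negbTE->.
  by rewrite IH sop_s; case: starts_overlined.
Qed.

Lemma uniq_separated_list N x n : uniq (separated_list N x n).
Proof.
elim: N x n => [|N IH] x n; first by rewrite /separated_list; case: ifP.
rewrite separated_listS cat_uniq IH andTb; apply/andP; split.
  apply/hasPn => _ /allpairsPdep[w [t [_ _ ->]]].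
  by rewrite mem_separated_list separated_overpartition_cons /part /= ltnn.
apply: allpairs_uniq_dep => [|w _|].
- exact/filter_uniq/iota_uniq.
- case: x; first by rewrite cats0.
  rewrite cat_uniq !IH andbT; apply/hasPn => t.
  by rewrite !mem_separated_list => /andP[_ /eqP->]; rewrite andbF.
- move=> _ _ /allpairsPdep[w [s [w_in _ ->]]] /allpairsPdep[w' [s' [w'_in _ ->]]].
  move: w_in w'_in; rewrite !mem_filter => /andP[/andP[_ dw] _] /andP[/andP[_ dw'] _].
  (* The multiplicity determines the weight, as both weights are multiples of [N.+1]. *)
  by move=> [/(congr1 (muln^~ N.+1))]; rewrite !divnK // => -> ->.
Qed.

(** No part of an overpartition of [n] exceeds [n], so the bound [n] excludes nothing; the two lists
    separate the final states. *)
Lemma b_size_separated_list n :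
  b n = (size (separated_list n false n) + size (separated_list n true n))%N.
Proof.
rewrite /b cardE -(size_map (@to_blocks n)) -size_cat.
apply/perm_size/uniq_perm.
- by rewrite map_inj_uniq ?enum_uniq //; apply: to_blocks_inj.
- rewrite cat_uniq !uniq_separated_list andbT; apply/hasPn => s.
  by rewrite !mem_separated_list => /andP[_ /eqP->]; rewrite andbF.
move=> s; rewrite mem_cat !mem_separated_list -andb_orr.
have -> : (starts_overlined s == false) || (starts_overlined s == true).
  by case: starts_overlined.
rewrite andbT.
have -> : separated_overpartition n n s = overpartition n s && block_separated s.
  rewrite /separated_overpartition /overpartition -!andbA.
  case: s => [|c s] //=.
  case: eqP => [sum_n|]; last by rewrite !andbF.
  case all_s: (_ && all _ _); last by rewrite !andbF.
  rewrite (_ : part c < n.+1)%N //.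
  case/andP: all_s => /andP[_ m_gt0] _.
  by rewrite ltnS -sum_n big_cons (leq_trans (leq_pmull _ m_gt0)) ?leq_addr.
apply/mapP/idP => [[t]|s_ok]; first by rewrite mem_enum inE => ? ->.
have /andP[/overpartition_bounded[t ts] _] := s_ok.
by exists t; rewrite // mem_enum inE ts.
Qed.

(** * Block series and step matrices *)

(** This is [q^j + q^(2j) + ...], one term for each positive multiplicity of [j]. *)
Definition blocks_gf (R : comNzRingType) (j : nat) : {fps R} :=
  FPS (fun n => ((0 < n)%N && (j %| n)%N)%:R).

Lemma blocks_gfE (R : comNzRingType) j : (0 < j)%N ->
  fpsX R ^+ j / (1 - fpsX R ^+ j) = blocks_gf R j.
Proof.
move=> j_gt0; apply: (canLR (mulrK (unitr_1subXn R j_gt0))).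
rewrite mulrC mulrBl mul1r; apply/fpsP => n.
transitivity (blocks_gf R j n - (fpsX R ^+ j * blocks_gf R j) n) => //.
rewrite -[fpsX R ^+ j]mulr1 -mulrA !coefs_fpsXnM mul1r /=.
case: ltnP => [n_lt_j|j_le_n].
  by rewrite subr0; case: n n_lt_j => //= n n_lt_j; rewrite gtnNdvd.
rewrite subn_gt0 (leq_trans j_gt0 j_le_n) /= subn_eq0.
rewrite -{2}(subnK j_le_n) dvdn_addl //.
(* At [n = j] the shifted series contributes its zero constant term, which leaves exactly [q^j]. *)
case: (ltngtP j n) j_le_n => [||<-] //= _; first by rewrite subrr.
by rewrite subnn dvdn0 subr0.
Qed.

(** Index 1 is the overlined state; only the transition from 1 to 1 is forbidden. *)
Definition separation_mx (R : pzRingType) : 'M[R]_2 :=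
  \matrix_(i, k) (~~ ((i != 0) && (k != 0)))%:R.

Lemma ME j : (0 < j)%N -> M j = 1 + blocks_gf int j *: separation_mx {fps int}.
Proof.
move=> j_gt0; have U := unitr_1subXn int j_gt0.
have diagE : 1 / (1 - 'q ^+ j) = 1 + blocks_gf int j.
  by rewrite -blocks_gfE // -[X in _ = X + _](divrr U) -mulrDl subrK.
apply/matrixP => i k; rewrite /M diagE blocks_gfE //.
case: i => [[|[|i]] lti] //; case: k => [[|[|k]] ltk] //.
all: rewrite !mxE; case: splitP => // i' /= Ei; rewrite !mxE.
all: case: splitP => // k' /= Ek; rewrite !mxE.
all: rewrite ?(ord1 i') ?(ord1 k') /=.
all: try by rewrite (ord1 i') in Ei.
all: try by rewrite (ord1 k') in Ek.
all: by rewrite ?mulr1 ?mulr0 ?addr0 ?add0r.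
Qed.

(** * Partial products and their limit *)

(** Each factor past [n] is the identity modulo [q^(n+1)]. *)
Lemma prodM_stable n m i k l : (l <= n)%N -> (n <= m)%N ->
  (\prod_(1 <= j < m.+1) M j) i k l = (\prod_(1 <= j < n.+1) M j) i k l.
Proof.
move=> le_ln /subnK <-; elim: (m - n)%N => [|d IH] //.
rewrite addSn big_nat_recr //= ME // -blocks_gfE // mulrDr mulr1.
rewrite -scalerAr mxE -IH /= mxE -mulrA.
set f := (_^-1 * _); set g := (X in X i k).
transitivity (g i k l + (fpsX int ^+ (d + n).+1 * f) l) => //.
by rewrite coefs_fpsXnM ltnS (leq_trans le_ln (leq_addl d n)) addr0.
Qed.

Lemma size_separated_listS N x n :
  size (separated_list N.+1 x n) =
  (size (separated_list N x n) +
   \sum_(w < n.+1 | (0 < w)%N && (N.+1 %| w)%N)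
     (size (separated_list N false (n - w)) +
      (~~ x) * size (separated_list N true (n - w))))%N.
Proof.
rewrite separated_listS size_cat size_allpairs_dep sumnE big_map big_filter.
rewrite big_mkord; congr (_ + _)%N; apply: eq_bigr => w _.
by rewrite size_cat; case: x; rewrite ?mul1n.
Qed.

(** Row 0 is the state of the empty list. Multiplying on the right by the next matrix reproduces the
    recursion of [separated_list]. *)
Lemma prodM_row0 N k n :
  (\prod_(1 <= j < N.+1) M j) 0 k n =
  (size (separated_list N (k != 0) n))%:Z.
Proof.
elim: N k n => [|N IH] k n.
  rewrite big_nil mxE eq_sym /separated_list.
  by case: (k == 0); case: n.
rewrite big_nat_recr //= ME // mulrDr mulr1 -scalerAr 3!mxE.
set p := (X in X 0 k); set g := (X in _ * X).
transitivity (p 0 k n + \sum_(w < n.+1) blocks_gf int N.+1 w * g (n - w)%N) => //.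
rewrite IH size_separated_listS PoszD; congr (_ + _).
rewrite -[Posz (\sum_(_ | _) _)%N]natz natr_sum [RHS]big_mkcond /=.
apply: eq_bigr => w _.
(* A block that is not overlined may follow either state, an overlined one only state 0. *)
have -> : g (n - w)%N = p 0 0 (n - w)%N + (~~ (k != 0))%:R * p 0 1 (n - w)%N.
  have -> : g = p 0 0 + (if k != 0 then 0 else p 0 1).
    rewrite /g !big_ord_recl big_ord0 !mxE mulr1 addr0.
    rewrite (_ : lift ord0 ord0 = 1) /=; last exact/val_inj.
    by case: (k != 0); rewrite ?mulr1 ?mulr0.
  by case: (k != 0); rewrite /= ?mul1r ?mul0r.
rewrite !IH natz PoszD PoszM.
by case: (k != 0); case: ifP; rewrite ?mul1r ?mul0r.
Qed.

Lemma mul_row10_col11 (R : pzRingType) (P : 'M[R]_2) :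
  ((row_mx 1%:M 0 : 'rV[R]_(1 + 1)) *m P
     *m (col_mx 1%:M 1%:M : 'cV[R]_(1 + 1))) 0 0 = P 0 0 + P 0 1.
Proof.
have -> : (row_mx 1%:M 0 : 'rV[R]_(1 + 1)) = delta_mx 0 0.
  apply/rowP => i; rewrite !mxE eqxx andTb.
  rewrite (_ : (i == 0) = (nat_of_ord i == 0)%N) //.
  by case: splitP => l ->; rewrite mxE ?(ord1 l).
have -> : (col_mx 1%:M 1%:M : 'cV[R]_(1 + 1)) = const_mx 1.
  by apply/colP => i; rewrite !mxE; case: splitP => l _; rewrite mxE (ord1 l).
rewrite -rowE mxE !big_ord_recl big_ord0 addr0 !mxE !mulr1.
by congr (_ + P 0 _); apply/val_inj.
Qed.

Theorem theorem2 :
  exists P : 'M[{fps int}]_2,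
    mx_infprod_cvg M P /\
    F = ((row_mx 1%:M 0 : 'rV[{fps int}]_(1 + 1)) *m P
           *m (col_mx 1%:M 1%:M : 'cV[{fps int}]_(1 + 1))) 0 0.
Proof.
(* The coefficient of [q^n] in the limit is read off the [n]-th partial product, where it is already
   stable. *)
pose P : 'M[{fps int}]_2 :=
  \matrix_(i, k) FPS (fun n => (\prod_(1 <= j < n.+1) M j) i k n).
exists P; split=> [i k n|].
  by exists n => m le_nm; rewrite mxE (prodM_stable n).
rewrite mul_row10_col11; apply/fpsP => n; rewrite !mxE.
transitivity ((\prod_(1 <= j < n.+1) M j) 0 0 n
              + (\prod_(1 <= j < n.+1) M j) 0 1 n) => //.
by rewrite !prodM_row0 /= b_size_separated_list.
Qed.
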